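(* Let $H$ be a separable infinite-dimensional Hilbert space, let $K,U,V$ be bounded linear operators on $H$, and let $\{f_j\}_{j\in\mathbb{Z}}$ be a sequence in $H$. Then the following statements hold. (i) If $\{f_j\}_{j\in\mathbb{Z}}$ is a scalable frame, then $\{Uf_j\}_{j\in\mathbb{Z}}$ is a $U_s$-frame with the same scaling as $\{f_j\}_{j\in\mathbb{Z}}$. (ii) If $\{f_j\}_{j\in\mathbb{Z}}$ is a $U_s$-frame, then $\{Vf_j\}_{j\in\mathbb{Z}}$ is a $(VU)_s$-frame with the same scaling as $\{f_j\}_{j\in\mathbb{Z}}$. (iii) If $\{f_j\}_{j\in\mathbb{Z}}$ and $\{Uf_j\}_{j\in\mathbb{Z}}$ are $K_s$-frames with the same scaling, then $\{f_j\}_{j\in\mathbb{Z}}$ is a $(UK)_s$-frame with the same scaling as $\{f_j\}_{j\in\mathbb{Z}}$. (iv) If $\{f_j\}_{j\in\mathbb{Z}}$ is a $K_s$-frame and $N\ge1$ is an integer, then $\{K^Nf_j\}_{j\in\mathbb{Z}}$ is a $(K^{N+1})_s$-frame with the same scaling as $\{f_j\}_{j\in\mathbb{Z}}$.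
   Context: Let $W$ be a bounded linear operator on $H$. A sequence $\{f_j\}_{j\in\mathbb{Z}}\subseteq H$ is a $W$-frame if there are constants $A,B>0$ with $A\|W^*f\|^2\le\sum_{j\in\mathbb{Z}}|\langle f,f_j\rangle|^2\le B\|f\|^2$ for every $f\in H$; it is a Parseval $W$-frame if $\sum_{j\in\mathbb{Z}}|\langle f,f_j\rangle|^2=\|W^*f\|^2$ for every $f\in H$. A $W$-frame $\{f_j\}_{j\in\mathbb{Z}}$ is a $W_s$-frame with scaling $\{c_j\}_{j\in\mathbb{Z}}\in\ell^\infty(\mathbb{Z})$ if $\{c_jf_j\}_{j\in\mathbb{Z}}$ is a Parseval $W$-frame, i.e. $\sum_{j\in\mathbb{Z}}\langle f,c_jf_j\rangle c_jf_j=WW^*f$ for every $f\in H$, equivalently $\sum_{j\in\mathbb{Z}}|\langle f,c_jf_j\rangle|^2=\|W^*f\|^2$ for every $f\in H$. A frame is a $W$-frame with $W$ the identity $I$; a scalable frame (with scaling $\{c_j\}$) is an $I_s$-frame, i.e. a frame $\{f_j\}$ such that $\{c_jf_j\}$ is a Parseval frame for some $\{c_j\}\in\ell^\infty(\mathbb{Z})$. ''With the same scaling'' means that the same sequence $\{c_j\}$ serves as a scaling. *)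

(* Defs.v *)
From HB Require Import structures.
From mathcomp Require Import all_boot all_order all_algebra.
From mathcomp Require Import complex.
From mathcomp Require Import all_classical all_reals all_analysis.

Set Implicit Arguments.
Unset Strict Implicit.
Unset Printing Implicit Defensive.

Import Order.TTheory GRing.Theory Num.Theory.
Import numFieldNormedType.Exports.

Local Open Scope classical_set_scope.
Local Open Scope ring_scope.

(* Hilbert spaces over the reals and over the complex numbers are treated
   uniformly: [scalar_field R k] is R or R[i] according to [k]. *)
Variant scalar_kind := RealScalars | ComplexScalars.

Definition scalar_field (R : realType) (k : scalar_kind) : numFieldType :=
  match k with RealScalars => R | ComplexScalars => R[i] end.

Definition scalar_conj (R : realType) (k : scalar_kind) :
    {rmorphism scalar_field R k -> scalar_field R k} :=
  match k return {rmorphism scalar_field R k -> scalar_field R k} with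
  | RealScalars => idfun
  | ComplexScalars => Num.conj
  end.

Definition scalar_re (R : realType) (k : scalar_kind) : scalar_field R k -> R :=
  match k return scalar_field R k -> R with
  | RealScalars => fun x => x
  | ComplexScalars => fun z => complex.Re z
  end.

Section Hilbert.
Variables (R : realType) (k : scalar_kind).
Local Notation F := (scalar_field R k).
Variable H : completeNormedModType F.

(* Linear in the first argument and conjugate-linear in the second one. *)
Variable dot : {dot H for scalar_conj R k}.

Definition norm_from_dot := forall x : H, `|x| ^+ 2 = dot x x.

Definition separable := exists2 D : set H, countable D & dense D.

Definition infinite_dimensional :=
  ~ exists (n : nat) (b : 'I_n -> H),
      forall x : H, exists a : 'I_n -> F, x = \sum_(i < n) a i *: b i.

Definition bounded_operator (W : {linear H -> H}) :=
  exists M : F, forall x : H, `|W x| <= M * `|x|.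

Definition is_adjoint (W W' : H -> H) :=
  forall x y : H, dot (W x) y = dot x (W' y).

(* For a bounded linear W on a Hilbert space such a W' exists (by the Riesz
   representation theorem) and is unique, so this is the usual W^*. *)
Definition adjoint (W : H -> H) : H -> H := get (is_adjoint W).

(* Norms take their values in the scalar field (as nonnegative elements);
   [sqnorm] and [analysis_sum] bring them back to R and to \bar R. *)
Definition sqnorm (x : H) : R := scalar_re (`|x| ^+ 2).

Definition analysis_sum (f : int -> H) (x : H) : \bar R :=
  \esum_(j in [set: int]) (scalar_re (`|dot x (f j)| ^+ 2))%:E.

Definition W_frame (W : H -> H) (f : int -> H) :=
  exists A B : R, [/\ 0 < A, 0 < B &
    forall x : H,
      ((A * sqnorm (adjoint W x))%:E <= analysis_sum f x)%E /\
      (analysis_sum f x <= (B * sqnorm x)%:E)%E].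

Definition Parseval_W_frame (W : H -> H) (f : int -> H) :=
  forall x : H, analysis_sum f x = (sqnorm (adjoint W x))%:E.

Definition linfty (c : int -> F) := exists M : F, forall j, `|c j| <= M.

Definition Ws_frame (W : H -> H) (f : int -> H) (c : int -> F) :=
  [/\ W_frame W f, linfty c & Parseval_W_frame W (fun j => c j *: f j)].

Definition scalable_frame (f : int -> H) (c : int -> F) := Ws_frame idfun f c.

End Hilbert.

(* Main.v *)
(* Since <V f_j, x> = <f_j, V^* x>, the analysis sums of (V f_j) at x are
   those of (f_j) at V^* x, and everything reduces to (VU)^* = U^* V^*.  The
   existence of V^* is the Riesz representation theorem: a bounded functional
   phi is represented by the minimiser of |x|^2 - 2 Re phi(x), the limit of
   the Cauchy filter of near-minimisers. *)
Require Import Defs.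
From HB Require Import structures.
From mathcomp Require Import all_boot all_order all_algebra.
From mathcomp Require Import complex.
From mathcomp Require Import all_classical all_reals all_analysis.
From mathcomp Require Import ring.
Import Order.TTheory GRing.Theory Num.Theory.
Import numFieldNormedType.Exports.
Local Open Scope ring_scope.

(** The order on [R[i]] is only partial, so infima are asked for nonempty sets having a lower bound;
    in this form the property holds for both scalar fields. *)
Definition has_infima (F : numFieldType) : Prop :=
  forall (S : set F) (b : F), (S !=set0)%classic -> (forall y, S y -> b <= y) ->
    exists m : F, (forall y, S y -> m <= y) /\
      (forall e, 0 < e -> exists2 y, S y & y < m + e).

(** * Riesz representation over an abstract field with conjugation [theta] *)

Section Riesz.
Local Open Scope classical_set_scope.
Variables (F : numFieldType) (theta : {rmorphism F -> F}).
Hypothesis thetaE : forall a : F, `|a| ^+ 2 = a * theta a.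
Hypothesis infF : has_infima F.
Variables (H : completeNormedModType F) (dot : {dot H for theta}).
Hypothesis dotE : forall x : H, `|x| ^+ 2 = dot x x.

Lemma norm_conj (a : F) : `|theta a| = `|a|.
Proof.
have [->|a0] := eqVneq a 0; first by rewrite rmorph0.
apply: (mulfI (_ : `|a| != 0)); first by rewrite normr_eq0.
by rewrite -normrM -thetaE -expr2 ger0_norm ?exprn_ge0.
Qed.

Lemma conj_nneg (a : F) : 0 <= a -> theta a = a.
Proof.
rewrite le_eqVlt => /orP[/eqP<-|a0]; first by rewrite rmorph0.
apply: (mulfI (_ : a != 0)); first by rewrite gt_eqF.
by rewrite -thetaE gtr0_norm // expr2.
Qed.

(** Polarisation expresses this substitute for 2 Re a through squared moduli, which are real. *)
Lemma addr_conj_real (a : F) : a + theta a \is Num.real.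
Proof.
have -> : a + theta a = `|a + 1| ^+ 2 - `|a| ^+ 2 - 1.
  by rewrite !thetaE rmorphD rmorph1; ring.
by rewrite !rpredB ?ger0_real ?exprn_ge0.
Qed.

Lemma addr_conj_le (a : F) : a + theta a <= 2 * `|a|.
Proof.
apply: (le_trans (real_ler_norm (addr_conj_real a))).
by rewrite (le_trans (ler_normD _ _)) // norm_conj mulr2n mulrDl mul1r.
Qed.

Lemma dotC (x y : H) : dot y x = theta (dot x y).
Proof. by rewrite hermC expr0 mul1r. Qed.

Lemma dotDl (x y z : H) : dot (x + y) z = dot x z + dot y z.
Proof. exact: linearDl. Qed.

Lemma dotDr (x y z : H) : dot x (y + z) = dot x y + dot x z.
Proof. exact: linearDr. Qed.

Lemma dotNl (x y : H) : dot (- x) y = - dot x y.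
Proof. exact: linearNl. Qed.

Lemma dotNr (x y : H) : dot x (- y) = - dot x y.
Proof. exact: linearNr. Qed.

Lemma dotZl a (x y : H) : dot (a *: x) y = a * dot x y.
Proof. exact: linearZl_LR. Qed.

Lemma dotZr a (x y : H) : dot x (a *: y) = theta a * dot x y.
Proof. exact: linearZr_LR. Qed.

Lemma dot_cauchy_schwarz (x y : H) : `|dot x y| <= `|x| * `|y|.
Proof.
have [->|y0] := eqVneq y 0; first by rewrite linear0r normr0 mulr_ge0.
have y1 : 0 < `|y| ^+ 2 by rewrite exprn_gt0 // normr_gt0.
rewrite -(ler_pXn2r (_ : (0 < 2)%N)) ?nnegrE ?mulr_ge0 //.
rewrite -(ler_pM2l y1) -subr_ge0.
(* This square expands to |y|^2 (|x|^2 |y|^2 - |<x,y>|^2). *)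
have : 0 <= `|(`|y| ^+ 2) *: x - dot x y *: y| ^+ 2 by rewrite exprn_ge0.
rewrite [X in 0 <= X]dotE !(dotDl, dotDr, dotNl, dotNr, dotZl, dotZr) -!dotE.
rewrite (dotC x y) (conj_nneg _ (ltW y1)) exprMn thetaE.
by congr (0 <= _); ring.
Qed.

Section Functional.
Variables (phi : H -> F) (M : F).
Hypothesis phi_lin : scalar phi.
Hypothesis phi_bounded : forall x, `|phi x| <= M * `|x|.
Hypothesis M_ge0 : 0 <= M.

(* [phi x + theta (phi x)] stands for [2 Re (phi x)]. *)
Let J x := `|x| ^+ 2 - (phi x + theta (phi x)).

(** Completing the square: |x|^2 - 2 M |x| = (|x| - M)^2 - M^2. *)
Let J_ge x : - M ^+ 2 <= J x.
Proof.
have h : phi x + theta (phi x) <= 2 * (M * `|x|).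
  by rewrite (le_trans (addr_conj_le _)) // ler_pM2l.
rewrite -subr_ge0.
have -> : J x - - M ^+ 2 =
  (`|x| - M) ^+ 2 + (2 * (M * `|x|) - (phi x + theta (phi x))).
  by rewrite /J; ring.
by rewrite addr_ge0 ?subr_ge0 // -realEsqr rpredB ?ger0_real.
Qed.

Let phiD x y : phi (x + y) = phi x + phi y.
Proof. by rewrite -{1}[x]scale1r phi_lin mul1r. Qed.

Let phi0 : phi 0 = 0.
Proof. by apply: (addrI (phi 0)); rewrite -phiD !addr0. Qed.

Let phiZ a x : phi (a *: x) = a * phi x.
Proof. by rewrite -{1}[a *: x]addr0 phi_lin phi0 addr0. Qed.

(** Parallelogram law, the linear terms cancelling. Near-minimisers are thus close to each other, as
    the value at their midpoint is at least the infimum. *)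
Let J_parallelogram x y :
  `|x - y| ^+ 2 = 2 * (J x + J y - 2 * J (2^-1 *: (x + y))).
Proof.
rewrite /J phiZ phiD rmorphM rmorphD fmorphV rmorph_nat normrZ exprMn.
rewrite !dotE !(dotDl, dotDr, dotNl, dotNr).
by rewrite ger0_norm ?invr_ge0 //; field.
Qed.

(** The first-order term shows that [dot v x - phi v] must vanish for every [v] if [x] minimises
    [J]. *)
Let J_perturb x v t : J (x + t *: v) = J x +
  (t * (dot v x - phi v) + theta (t * (dot v x - phi v))) +
  `|t| ^+ 2 * `|v| ^+ 2.
Proof.
rewrite /J phiD phiZ !dotE !(dotDl, dotDr, dotZl, dotZr).
rewrite (dotC v x) thetaE !(rmorphD, rmorphM, rmorphB) /=; ring.
Qed.

Lemma near_minimizer_sub (m e : F) (v x : H) : 0 < e ->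
  (forall y, m <= J y) -> J x < m + e ->
  `|dot v x - phi v| ^+ 2 < e * (`|v| ^+ 2 + 1).
Proof.
(* Compare [J] at [x] and at [x - s (theta a) v], with [s = 1 / (|v|^2 + 1)]. *)
move=> e0 mJ Jx; set a := dot v x - phi v; set q : F := `|v| ^+ 2 + 1.
have q0 : 0 < q by rewrite ltr_wpDl ?exprn_ge0.
set s : F := q^-1; have s0 : 0 < s by rewrite invr_gt0.
have sN0 : 0 <= s * `|a| ^+ 2 by rewrite mulr_ge0 ?exprn_ge0 // ltW.
have taE : - (s * theta a) * a = - (s * `|a| ^+ 2) by rewrite thetaE; ring.
have tN : `|- (s * theta a)| ^+ 2 = s ^+ 2 * `|a| ^+ 2.
  by rewrite normrN normrM norm_conj gtr0_norm // exprMn.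
have sq : s * q = 1 by rewrite mulVf // gt_eqF.
have vE : `|v| ^+ 2 = q - 1 by rewrite addrK.
have e2 : s ^+ 2 * (q - 1) = s - s ^+ 2.
  by rewrite mulrBr mulr1 expr2 -mulrA sq mulr1.
(* The first-order term gives -2 s |a|^2, the quadratic one s^2 (q - 1) |a|^2 = (s - s^2) |a|^2. *)
have Jt : J (x + - (s * theta a) *: v) =
    J x - s * `|a| ^+ 2 - s ^+ 2 * `|a| ^+ 2.
  rewrite J_perturb -/a taE tN vE rmorphN (conj_nneg _ sN0).
  by rewrite mulrAC e2; ring.
have sNe : s * `|a| ^+ 2 < e.
  have := le_lt_trans (mJ (x + (- (s * theta a)) *: v)).
  move=> /(_ (m + e - s * `|a| ^+ 2)); rewrite Jt.
  have h : J x - s * `|a| ^+ 2 - s ^+ 2 * `|a| ^+ 2 < m + e - s * `|a| ^+ 2.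
    rewrite ltrBlDr (lt_le_trans (_ : _ < m + e - s * `|a| ^+ 2)) ?ltrD2r //.
    by rewrite lerDl mulr_ge0 ?exprn_ge0 // ltW.
  by move=> /(_ h); rewrite -addrA ltrDl subr_gt0.
by rewrite -(ltr_pM2l s0) [ltRHS]mulrCA sq mulr1.
Qed.

Lemma riesz_representation : exists z : H, forall x, phi x = dot x z.
Proof.
have [|_ [x0 _ <-]|m [mJ infJ]] := infF (range J) (- M ^+ 2).
- by exists (J 0), 0.
- exact: J_ge.
have {}mJ y : m <= J y by apply: mJ; exists y.
have {}infJ e : 0 < e -> exists x, J x < m + e.
  by move=> /infJ[_ [x _ <-] ?]; exists x.
pose S e := [set x | J x < m + e].
pose G := filter_from [set e : F | 0 < e] S.
have GF : ProperFilter G.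
  apply: filter_from_proper; last by move=> e /infJ[x ?]; exists x.
  apply: filter_from_filter; first by exists 1 => /=.
  (* Positive elements are real, hence comparable although the order on [F] may be partial. *)
  move=> i j /= i0 j0; have [ij|ji] := real_leP (gtr0_real i0) (gtr0_real j0).
    exists i => // x Sx; split => //; apply: lt_le_trans Sx _.
    by rewrite lerD2l.
  exists j => // x Sx; split => //; apply: lt_trans Sx _.
  by rewrite ltrD2l.
have Gc : cauchy G.
  apply: cauchy_exP => e e0.
  (* With this tolerance, [J_parallelogram] gives |x - y|^2 < 2 (2 (m + e^2/4) - 2 m) = e^2. *)
  have d0 : 0 < e ^+ 2 / 4 by rewrite divr_gt0 ?exprn_gt0.
  have [x Jx] := infJ _ d0; exists x, (e ^+ 2 / 4) => // y Jy.
  rewrite -ball_normE /= -(ltr_pXn2r (_ : (0 < 2)%N)) ?nnegrE ?(ltW e0) //.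
  rewrite J_parallelogram -ltr_pdivlMl //.
  have -> : 2^-1 * e ^+ 2 =
      (m + e ^+ 2 / 4) + (m + e ^+ 2 / 4) - 2 * m by field.
  by apply: ltr_leD; [apply: ltrD | rewrite lerN2 ler_pM2l].
have /cauchy_cvgP/cvg_ex[z Gz] := Gc.
exists z => v; apply/esym/eqP; rewrite -subr_eq0 -normr_le0.
apply/ler_addgt0Pl => d d0; rewrite addr0.
have d2 : 0 < d / 2 by rewrite divr_gt0.
have q0 : 0 < `|v| ^+ 2 + 1 by rewrite ltr_wpDl ?exprn_ge0.
have v0 : 0 < `|v| + 1 by rewrite ltr_wpDl.
(* The tolerances make |v| |z - x| at most d/2 and, by [near_minimizer_sub], |<v,x> - phi v| at most
   d/2. *)
have [x [Jx zx]] : exists x, J x < m + (d / 2) ^+ 2 / (`|v| ^+ 2 + 1) /\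
    `|z - x| < d / 2 / (`|v| + 1).
  have GS : G (S ((d / 2) ^+ 2 / (`|v| ^+ 2 + 1))).
    by eexists; last exact: subset_refl; rewrite /= divr_gt0 ?exprn_gt0.
  have GB : G (ball z (d / 2 / (`|v| + 1))).
    by apply: Gz; apply: nbhsx_ballx; rewrite divr_gt0.
  have [x [Sx Bx]] := filter_ex (filterI GS GB).
  by exists x; split => //; move: Bx; rewrite -ball_normE.
rewrite (splitr d).
have -> : dot v z - phi v = dot v (z - x) + (dot v x - phi v).
  by rewrite dotDr dotNr; ring.
rewrite (le_trans (ler_normD _ _)) // lerD //.
  rewrite (le_trans (dot_cauchy_schwarz _ _)) //.
  rewrite (le_trans (ler_wpM2l (normr_ge0 v) (ltW zx))) // mulrCA.
  by rewrite ger_pMr // ler_pdivrMr // mul1r lerDl.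
rewrite -(ler_pXn2r (_ : (0 < 2)%N)) ?nnegrE ?(ltW d2) //.
have := near_minimizer_sub _ _ v _ _ mJ Jx; rewrite divfK ?gt_eqF // => h.
by apply/ltW/h; rewrite divr_gt0 ?exprn_gt0.
Qed.
End Functional.
End Riesz.

(** * Conjugation, infima and real parts for real and complex scalars *)

Section Scalars.
Local Open Scope classical_set_scope.
Variable R : realType.

Lemma scalar_normsqE k (a : scalar_field R k) :
  `|a| ^+ 2 = a * scalar_conj R k a.
Proof.
case: k a => /= a; last exact: normCK.
by rewrite real_normK ?num_real // expr2.
Qed.

Lemma realType_has_infima : has_infima R.
Proof.
move=> S b S0 Sb; have hS : has_inf S by split => //; exists b => y /Sb.
exists (inf S); split; first by apply: ge_inf; case: hS.
by move=> e e0; apply: inf_adherent.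
Qed.

(* Elements bounded below by [b] all have the imaginary part of [b]. *)
Lemma complex_has_infima : has_infima R[i].
Proof.
move=> S b [s Ss] Sb.
have [||m [mS infS]] :=
  @realType_has_infima (@complex.Re R @` S) (complex.Re b).
- by exists (complex.Re s), s.
- by move=> _ [y /Sb + <-]; rewrite lecE => /andP[].
have SE y : S y -> complex.Im y = complex.Im b.
  by move=> /Sb; rewrite lecE => /andP[/eqP].
exists (Complex m (complex.Im b)); split.
  by move=> y Sy; rewrite lecE /= (SE _ Sy) eqxx mS //; exists y.
move=> [e i]; rewrite ltcE /= => /andP[/eqP-> e0].
have [_ [y Sy <-] ye] := infS _ e0.
by exists y => //; rewrite ltcE /= (SE _ Sy) addr0 eqxx.
Qed.

Lemma scalar_has_infima k : has_infima (scalar_field R k).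
Proof. by case: k; [exact: realType_has_infima | exact: complex_has_infima]. Qed.

Lemma scalar_re_le k (a b : scalar_field R k) :
  a <= b -> scalar_re a <= scalar_re b.
Proof. by case: k a b => //= a b; rewrite lecE => /andP[]. Qed.

Lemma scalar_re_ge0 k (a : scalar_field R k) : 0 <= a -> 0 <= scalar_re a.
Proof. by case: k a => //= a; rewrite lecE => /andP[]. Qed.

(** A nonnegative factor has zero imaginary part, so the product of imaginary parts disappears. *)
Lemma scalar_reM k (a b : scalar_field R k) :
  0 <= a -> scalar_re (a * b) = scalar_re a * scalar_re b.
Proof.
case: k a b => //= -[a a'] [b b']; rewrite lecE /= => /andP[/eqP-> _].
by rewrite mul0r subr0.
Qed.

End Scalars.

(** * Adjoints of bounded operators *)

Section Adjoint.
Variables (R : realType) (k : scalar_kind).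
Variable H : completeNormedModType (scalar_field R k).
Variable dot : {dot H for scalar_conj R k}.
Hypothesis dotE : norm_from_dot dot.

(** [adjoint] is a choice by [get], meaningful only once some adjoint exists. The bound is stated
    for [sqnorm] because upper frame bounds use it in that form. Plain functions are allowed so that
    compositions and iterates fit. *)
Definition adjointable (W : H -> H) :=
  is_adjoint dot W (adjoint dot W) /\
  exists2 B : R, 0 < B & forall x, sqnorm (adjoint dot W x) <= B * sqnorm x.

Lemma dot_right_inj (y z : H) : (forall x, dot x y = dot x z) -> y = z.
Proof.
move=> e; apply/eqP; rewrite -subr_eq0 -normr_eq0 -sqrf_eq0 dotE.
by rewrite [X in X == 0]linearBr /= e subrr.
Qed.

(** Nondegeneracy of [dot] identifies the value chosen by [get] with any adjoint exhibited by
    hand. *)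
Lemma adjoint_unique (W W' : H -> H) :
  is_adjoint dot W W' -> adjoint dot W = W'.
Proof.
move=> WW'; apply/funext => y; apply: dot_right_inj => x.
by rewrite -WW' -(getPex (ex_intro (is_adjoint dot W) _ WW')).
Qed.

Lemma sqnorm_ge0 (x : H) : 0 <= sqnorm x.
Proof. by rewrite scalar_re_ge0 // exprn_ge0. Qed.

Lemma adjoint_id : adjoint dot idfun = idfun.
Proof. exact: adjoint_unique. Qed.

Lemma adjointable_id : adjointable idfun.
Proof.
rewrite /adjointable adjoint_id; split=> //.
by exists 1 => // x; rewrite mul1r.
Qed.

Lemma adjoint_comp (V U : H -> H) : adjointable V -> adjointable U ->
  adjoint dot (V \o U) = adjoint dot U \o adjoint dot V.
Proof.
by move=> [VV _] [UU _]; apply: adjoint_unique => x y /=; rewrite VV UU.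
Qed.

Lemma adjointable_comp (V U : H -> H) : adjointable V -> adjointable U ->
  adjointable (V \o U).
Proof.
move=> aV aU; rewrite /adjointable adjoint_comp //.
case: aV aU => [VV [B B0 VB]] [UU [C C0 UC]].
split=> [x y /=|]; first by rewrite VV UU.
exists (C * B) => [|x /=]; first by rewrite mulr_gt0.
by rewrite (le_trans (UC _)) // -mulrA ler_pM2l.
Qed.

Lemma adjointable_iter (W : H -> H) n : adjointable W -> adjointable (iter n W).
Proof.
move=> aW; elim: n => [|n IHn]; first exact: adjointable_id.
exact: adjointable_comp.
Qed.

Lemma bounded_operator_adjointable (W : {linear H -> H}) :
  bounded_operator W -> adjointable W.
Proof.
have CS := dot_cauchy_schwarz _ _ (@scalar_normsqE R k) _ _ dotE.
move=> [M WM].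
(* The given [M] need not be nonnegative when H is trivial; its modulus is, and still bounds [W]. *)
have {}WM x : `|W x| <= `|M| * `|x|.
  rewrite -[X in _ * X]normr_id -normrM.
  rewrite (le_trans (WM x)) // real_ler_norm //.
  by rewrite (ger0_real (le_trans _ (WM x))).
have [W' WW'] : exists W', is_adjoint dot W W'.
  suff /choice[W' WW'] y : exists z, forall x, dot (W x) y = dot x z.
    by exists W' => x y; apply: WW'.
  apply: (@riesz_representation _ _ (@scalar_normsqE R k)
    (@scalar_has_infima R k) _ dot dotE (fun x => dot (W x) y) (`|M| * `|y|)).
  - by move=> a u v; rewrite linearP dotDl dotZl.
  - move=> x; rewrite (le_trans (CS _ _)) //.
    by rewrite mulrAC ler_wpM2r.
  - by rewrite mulr_ge0.
rewrite /adjointable (adjoint_unique _ _ WW'); split=> //.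
(* Adding 1 keeps the constant positive even if [M] is 0. *)
exists (scalar_re (`|M| ^+ 2) + 1) => [|x].
  by rewrite ltr_wpDl // scalar_re_ge0 // exprn_ge0.
(* Cancel |W'x| in |W'x|^2 = <W W'x, x> <= |M| |W'x| |x|. *)
have W'M : `|W' x| <= `|M| * `|x|.
  have [->|W'x0] := eqVneq (W' x) 0; first by rewrite normr0 mulr_ge0.
  rewrite -(ler_pM2l (_ : 0 < `|W' x|)) ?normr_gt0 // -expr2 dotE -WW'.
  have le_norm : dot (W (W' x)) x <= `|dot (W (W' x)) x|.
    by rewrite real_ler_norm // WW' -dotE ger0_real ?exprn_ge0.
  rewrite (le_trans le_norm) // (le_trans (CS _ _)) //.
  by rewrite mulrA [_ * `|M|]mulrC ler_wpM2r.
apply: (@le_trans _ _ (scalar_re (`|M| ^+ 2) * sqnorm x)).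
  rewrite -scalar_reM ?exprn_ge0 // -exprMn scalar_re_le //.
  by rewrite ler_pXn2r ?nnegrE ?mulr_ge0.
by rewrite ler_wpM2r ?sqnorm_ge0 // lerDl.
Qed.

(** Having an adjoint forces homogeneity, which lets the scaling pass through maps that carry no
    linear structure in their type. *)
Lemma adjointableZ (V : H -> H) a x : adjointable V -> V (a *: x) = a *: V x.
Proof.
move=> [VV _]; apply: dot_right_inj => y.
by rewrite dotC [RHS]dotC VV !dotZl VV.
Qed.

(** * Analysis sums and frames under an operator *)

Lemma analysis_sum_op (V : H -> H) (f : int -> H) x : adjointable V ->
  analysis_sum dot (fun j => V (f j)) x = analysis_sum dot f (adjoint dot V x).
Proof.
move=> [VV _]; apply: eq_esum => j _.
by rewrite dotC VV -dotC.
Qed.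

Lemma analysis_sum_scaled_op (V : H -> H) (f : int -> H)
    (c : int -> scalar_field R k) x : adjointable V ->
  analysis_sum dot (fun j => c j *: V (f j)) x =
  analysis_sum dot (fun j => c j *: f j) (adjoint dot V x).
Proof.
move=> aV; rewrite -analysis_sum_op //.
by apply: eq_esum => j _; rewrite adjointableZ.
Qed.

(** Common source of (i), (ii) and (iv): the frame inequalities and the Parseval identity for [U]
    are evaluated at V^* x. *)
Lemma Ws_frame_comp (U V : H -> H) (f : int -> H) (c : int -> scalar_field R k) :
  adjointable U -> adjointable V ->
  Ws_frame dot U f c -> Ws_frame dot (V \o U) (fun j => V (f j)) c.
Proof.
move=> aU aV [[A [B [A0 B0 fAB]]] c_bounded cP]; split => //.
- have [_ [C C0 VC]] := aV.
  (* The lower bound is kept because U^* V^* = (VU)^*; the upper one picks up [C] from |V^* x|^2 <=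
     C |x|^2. *)
  exists A, (B * C); split; [by []|by rewrite mulr_gt0|move=> x].
  rewrite analysis_sum_op // adjoint_comp //=.
  have [fA fB] := fAB (adjoint dot V x); split => //; apply: (le_trans fB).
  by rewrite lee_fin -mulrA ler_pM2l.
- by move=> x; rewrite analysis_sum_scaled_op // cP adjoint_comp.
Qed.

(* Computing the Parseval sum of [c_j U f_j] in two ways gives
   [|K^* x| = |K^* U^* x|]. *)
Lemma Ws_frame_common_scaling (K U : H -> H) (f : int -> H)
    (c : int -> scalar_field R k) :
  adjointable K -> adjointable U ->
  Ws_frame dot K f c -> Ws_frame dot K (fun j => U (f j)) c ->
  Ws_frame dot (U \o K) f c.
Proof.
move=> aK aU [[A [B [A0 B0 fAB]]] c_bounded cP] [_ _ cUP].
have adjE x : sqnorm (adjoint dot (U \o K) x) = sqnorm (adjoint dot K x).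
  rewrite adjoint_comp //=; apply: EFin_inj.
  by rewrite -(cUP x) analysis_sum_scaled_op // cP.
split => //; last by move=> x; rewrite adjE cP.
(* The operator enters the frame inequalities only through the norm of its adjoint, so the constants
   for [K] serve again. *)
by exists A, B; split => // x; rewrite adjE.
Qed.

End Adjoint.

Theorem theorem3p1 (R : realType) (k : scalar_kind)
    (H : completeNormedModType (scalar_field R k))
    (dot : {dot H for scalar_conj R k})
    (dotE : norm_from_dot dot)
    (sepH : separable H) (infH : infinite_dimensional H)
    (K U V : {linear H -> H})
    (bK : bounded_operator K) (bU : bounded_operator U)
    (bV : bounded_operator V)
    (f : int -> H) :
  (forall c : int -> scalar_field R k,
     scalable_frame dot f c -> Ws_frame dot U (fun j => U (f j)) c) /\
  (forall c : int -> scalar_field R k,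
     Ws_frame dot U f c -> Ws_frame dot (V \o U) (fun j => V (f j)) c) /\
  (forall c : int -> scalar_field R k,
     Ws_frame dot K f c -> Ws_frame dot K (fun j => U (f j)) c ->
     Ws_frame dot (U \o K) f c) /\
  (forall (N : nat) (c : int -> scalar_field R k),
     (1 <= N)%N -> Ws_frame dot K f c ->
     Ws_frame dot (iter N.+1 K) (fun j => iter N K (f j)) c).
Proof.
have aK : adjointable _ _ _ dot K by apply: bounded_operator_adjointable.
have aU : adjointable _ _ _ dot U by apply: bounded_operator_adjointable.
have aV : adjointable _ _ _ dot V by apply: bounded_operator_adjointable.
(* Statement (i) is the composition lemma with the identity as inner operator. *)
split=> [c|]; first exact: Ws_frame_comp (adjointable_id _ _ _ _ dotE) aU.
split=> [c|]; first exact: Ws_frame_comp.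
split=> [c|N c _]; first exact: Ws_frame_common_scaling.
(* For (iv) the outer operator is K^N, so the extra factor, which [iter] puts outside, is moved
   inside. *)
have -> : iter N.+1 K = iter N K \o K by apply/funext => x; rewrite /= -iterSr.
by apply: Ws_frame_comp => //; apply: adjointable_iter.
Qed.
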